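(* Let $G$ be a $\mathfrak{Small}$-ary clone on a small set $A$. Then $G^{\perp(\mathfrak{Small})}$ is the set of all $\mathfrak{Small}$-ary operations $f:A^X \rightarrow A$ such that $h(f) = f(h \circ u_X)$ for every operation $h:A^{(A^X)} \rightarrow A$ of arity $A^X$ in $G$, where $u_X:X\to A^{(A^X)}$ is the map that sends each $x\in X$ to the projection $\pi_x:A^X\to A$.
   Context: Fix a Grothendieck universe $\mathfrak{Small}$, i.e. the set of all sets of rank less than a fixed inaccessible cardinal; its elements are called small sets. A $\mathfrak{Small}$-ary operation on a set $A$ is a map $A^X \to A$ with $X$ a small set (its arity); nullary operations are allowed. A $\mathfrak{Small}$-ary clone on $A$ is a set $F$ of $\mathfrak{Small}$-ary operations on $A$ that contains all projections $\pi_x:A^X\to A$ ($X$ small, $x\in X$) and is such that for all small $X,Y$, every $f:A^Y\to A$ in $F$ and every family $g_y:A^X\to A$ $(y\in Y)$ in $F$, the composite $f\circ(g_y)_{y\in Y}:A^X\to A$ lies in $F$. Operations $f:A^X\to A$ and $g:A^Y\to A$ commute, written $f\perp g$, if for every matrix $a=(a_{xy})\in A^{X\times Y}$ one has $g\bigl((f((a_{xy})_{x\in X}))_{y\in Y}\bigr)=f\bigl((g((a_{xy})_{y\in Y}))_{x\in X}\bigr)$. For a set $G$ of $\mathfrak{Small}$-ary operations on $A$, the $\mathfrak{Small}$-ary centralizer $G^{\perp(\mathfrak{Small})}$ is the set of all $\mathfrak{Small}$-ary operations $f$ on $A$ with $f\perp g$ for all $g\in G$. In $h(f)$, the map $f:A^X\to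 A$ is regarded as an element of $A^{(A^X)}$; and $h\circ u_X:X\to A$ is regarded as an element of $A^X$. *)

(* Defs.v *)
From mathcomp Require Import all_boot.
From mathcomp Require Import classical_sets.

Set Implicit Arguments.
Unset Strict Implicit.
Unset Printing Implicit Defensive.

Local Open Scope classical_set_scope.

(* The Grothendieck universe is rendered by one fixed universe of types: it is
   closed under function types, and [operation A] below lives strictly above
   it, as the set of all Small-ary operations on A is not itself small. *)
Definition Small := Type.

Record operation (A : Small) := Operation {
  arity : Small;
  op_fun : (arity -> A) -> A
}.
Arguments Operation {A arity} op_fun.
Arguments op_fun {A} _ _.

Definition proj (A X : Small) (x : X) : (X -> A) -> A := fun a => a x.

Definition comp_op (A X Y : Small) (f : (Y -> A) -> A)
    (g : Y -> ((X -> A) -> A)) : (X -> A) -> A :=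
  fun a => f (fun y => g y a).

Definition is_clone (A : Small) (F : set (operation A)) : Prop :=
  (forall (X : Small) (x : X), F (Operation (@proj A X x))) /\
  (forall (X Y : Small) (f : (Y -> A) -> A) (g : Y -> ((X -> A) -> A)),
     F (Operation f) -> (forall y, F (Operation (g y))) ->
     F (Operation (comp_op f g))).

Definition commute_op (A : Small) (f g : operation A) : Prop :=
  forall a : arity f * arity g -> A,
    op_fun g (fun y => op_fun f (fun x => a (x, y))) =
    op_fun f (fun x => op_fun g (fun y => a (x, y))).

Definition centralizer_op (A : Small) (G : set (operation A)) :
    set (operation A) :=
  [set f | forall g, G g -> commute_op f g].

Definition proj_family (A X : Small) : X -> ((X -> A) -> A) :=
  fun x => @proj A X x.

(* Main.v *)
(* A matrix [a] in [A^(X * Y)] is a substitution turning an operation [g] of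
   arity [Y] into [h := phi |-> g (fun y => phi (a (_, y)))] of arity [A^X],
   which lies in the clone; the condition for [h] is exactly the commutation of
   [f] and [g] on [a]. Conversely, the condition for [h] is the commutation of
   [f] and [h] on the evaluation matrix [(x, p) |-> p x]. *)
Require Import Defs.
From mathcomp Require Import all_boot.
From mathcomp Require Import classical_sets.

Local Open Scope classical_set_scope.

Theorem corollary5p5 (A : Small) (G : set (operation A)) (hG : is_clone G) :
  centralizer_op G =
  [set f : operation A |
     forall h : ((arity f -> A) -> A) -> A,
       G (Operation h) ->
       h (op_fun f) = op_fun f (h \o @proj_family A (arity f))].
Proof.
have [G_proj G_comp] := hG.
apply/seteqP; split=> f /= f_prop.
  move=> h Gh.
  (* Column [p] of this matrix is [p] itself and row [x] is [proj_family x], so the commutation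
     equation is the goal up to conversion. *)
  exact: (f_prop _ Gh (fun xp => xp.2 xp.1)).
case=> Y g Gg a.
(* Each column of [a] is a point of [arity f -> A], hence indexes a projection of arity
   [arity f -> A]. *)
have Gh := G_comp _ _ g
  (fun y => @proj A (arity f -> A) (fun x => a (x, y))) Gg (fun y => G_proj _ _).
(* At [op_fun f] the composite applies [g] to the values of [f] on the columns; at [proj_family x]
   it applies [g] to row [x]. *)
exact: (f_prop _ Gh).
Qed.
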